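(* Let $g(x,y,z)$ be a real-valued function of positive real variables such that $\frac{R}{r}\geq g(a,b,c)$ holds for all Euclidean triangles with circumradius $R$, inradius $r$, and side lengths $a,b,c$. Then for all spherical triangles with circumradius $R$, inradius $r$, and side lengths $a,b,c$, $$\frac{\tan R}{\tan r}\geq g\left(\sin\tfrac a2,\sin\tfrac b2,\sin\tfrac c2\right).$$
   Context: Triangles are nondegenerate. Spherical geometry is the geometry of the unit sphere in $\mathbb{R}^3$; a spherical triangle has three vertices not lying on a common great circle, joined by minor great-circle arcs, and its side lengths are the lengths of these arcs. The circumradius $R<\pi/2$ of a spherical triangle is the spherical radius of the circle through its vertices, and the inradius $r$ is the spherical radius of its inscribed circle. *)

(* Defs.v *)
From mathcomp Require Import all_boot all_order all_algebra.
From mathcomp Require Import all_classical all_reals all_analysis.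

Set Implicit Arguments.
Unset Strict Implicit.
Unset Printing Implicit Defensive.

Import Order.TTheory GRing.Theory Num.Theory.

Local Open Scope classical_set_scope.
Local Open Scope ring_scope.

(* The library norm on 'rV[R]_n is the sup norm, so the Euclidean inner product
   and distance are introduced here. *)
Definition dotp (R : realType) (n : nat) (u v : 'rV[R]_n) : R :=
  \sum_(i < n) u 0 i * v 0 i.

Section Euclidean.
Variable R : realType.
Implicit Types A B C P X n : 'rV[R]_2.

Definition euclidean_dist A B : R := Num.sqrt (dotp (B - A) (B - A)).

Definition eline n (c : R) : set 'rV[R]_2 := [set X | dotp n X = c].

Definition euclidean_triangle A B C : Prop :=
  ~ exists n c, [/\ n != 0, eline n c A, eline n c B & eline n c C].

Definition ecircle P (rho : R) : set 'rV[R]_2 := [set X | euclidean_dist P X = rho].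
Definition edisc P (rho : R) : set 'rV[R]_2 := [set X | euclidean_dist P X <= rho].

Definition esegment A B : set 'rV[R]_2 :=
  [set X | exists s t : R,
     [/\ 0 <= s, 0 <= t, s + t = 1 & X = s *: A + t *: B]].

Definition eregion A B C : set 'rV[R]_2 :=
  [set X | exists s t u : R,
     [/\ 0 <= s, 0 <= t, 0 <= u, s + t + u = 1 &
         X = s *: A + t *: B + u *: C]].

Definition euclidean_circumradius A B C (rho : R) : Prop :=
  exists P, [/\ ecircle P rho A, ecircle P rho B & ecircle P rho C].

Definition etangent P (rho : R) A B : Prop :=
  exists! X, (esegment A B `&` ecircle P rho) X.

Definition euclidean_inradius A B C (rho : R) : Prop :=
  0 < rho /\
  exists P, edisc P rho `<=` eregion A B C /\
    [/\ etangent P rho B C, etangent P rho C A & etangent P rho A B].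

End Euclidean.

Section Spherical.
Variable R : realType.
Implicit Types A B C P X n : 'rV[R]_3.

Definition unit_sphere : set 'rV[R]_3 := [set X | dotp X X = 1].

(* For points of the unit sphere: the angle between them, i.e. the length of
   the minor great-circle arc joining them. *)
Definition spherical_dist A B : R := acos (dotp A B).

(* Section of the sphere by the plane through 0 with normal vector n. *)
Definition great_circle n : set 'rV[R]_3 :=
  unit_sphere `&` [set X | dotp n X = 0].

Definition spherical_triangle A B C : Prop :=
  [/\ unit_sphere A, unit_sphere B & unit_sphere C] /\
  ~ exists n, [/\ n != 0, great_circle n A, great_circle n B
                & great_circle n C].

Definition scircle P (rho : R) : set 'rV[R]_3 :=
  unit_sphere `&` [set X | spherical_dist P X = rho].
Definition sdisc P (rho : R) : set 'rV[R]_3 :=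
  unit_sphere `&` [set X | spherical_dist P X <= rho].

(* The minor arc is the radial projection of the chord, i.e. the trace on the
   sphere of the cone spanned by the endpoints (taken non-antipodal); likewise
   the triangular region is the trace of the cone spanned by the vertices. *)
Definition minor_arc A B : set 'rV[R]_3 :=
  unit_sphere `&` [set X | exists s t : R,
     [/\ 0 <= s, 0 <= t & X = s *: A + t *: B]].

Definition sregion A B C : set 'rV[R]_3 :=
  unit_sphere `&` [set X | exists s t u : R,
     [/\ 0 <= s, 0 <= t, 0 <= u & X = s *: A + t *: B + u *: C]].

(* A circle has two spherical centres; the bound selects the smaller radius. *)
Definition spherical_circumradius A B C (rho : R) : Prop :=
  rho < pi / 2 /\
  exists P, unit_sphere P /\
    [/\ scircle P rho A, scircle P rho B & scircle P rho C].

Definition stangent P (rho : R) A B : Prop :=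
  exists! X, (minor_arc A B `&` scircle P rho) X.

Definition spherical_inradius A B C (rho : R) : Prop :=
  0 < rho /\
  exists P, [/\ unit_sphere P, sdisc P rho `<=` sregion A B C &
    [/\ stangent P rho B C, stangent P rho C A & stangent P rho A B]].

End Spherical.

(* Main.v *)
Require Import Defs.
From mathcomp Require Import all_boot all_order all_algebra.
From mathcomp Require Import all_classical all_reals all_analysis.
From mathcomp Require Import ring lra.

Set Implicit Arguments.
Unset Strict Implicit.
Unset Printing Implicit Defensive.

Import Order.TTheory GRing.Theory Num.Theory.

Local Open Scope ring_scope.

(** Let N be the circumcentre of the spherical triangle ABC and d = cos Rc, so
    that the plane N . X = d contains A, B and C.  The chord triangle ABC in
    that plane has side lengths 2 sin (a/2), 2 sin (b/2), 2 sin (c/2) and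
    circumradius sin Rc.  The hypothesis on g, applied to this triangle scaled
    by 1/2, therefore bounds g (sin (a/2), sin (b/2), sin (c/2)) by
    sin Rc / r', where r' is the inradius of the chord triangle.  Since
    sin Rc = d * tan Rc, it remains to see that r' >= d * tan r.

    Geometrically, the cone over the inscribed circle meets the plane
    N . X = d in an ellipse that lies in the chord triangle and whose semi-axes
    are at least d * tan r.  The proof is a dual version of this remark.
    For a positively oriented triangle (otherwise exchange B and C) let V run
    through the three face normals B x C, C x A, A x B.
    - The disc of radius r about P lies in the half-space V . X >= 0, so
      V . P >= |V| sin r ([cap_in_halfspace]).
    - Splitting V along N and orthogonally to N gives
      |V|^2 = (V . N)^2 + (d l)^2, with l the chord on that face, and hence
      |V| >= sin r (V . N) + cos r (d l) ([chord_le_cross]).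
    - The three normals add up to (B - A) x (C - A) = T N, where T is twice the
      area of the chord triangle.
    Summing over the faces, with L the perimeter of the chord triangle,
    sin r (sin r T + cos r d L) <= sin r (sum of |V|) <= T (N . P) <= T, which
    simplifies to d L tan r <= T = L r' ([cos_tan_inradius]).

    The Euclidean side needs that |det| / perimeter is the inradius of a plane
    triangle ([euclidean_inradiusP]), and a similarity of ratio 1/2 from the
    plane N . X = d to the coordinate plane ([half_chart]). *)

(** * Dot products in any dimension *)

Section DotProduct.
Variables (R : realType) (n : nat).
Implicit Types (u v w P V X : 'rV[R]_n) (k r : R).

Lemma dotpC u v : dotp u v = dotp v u.
Proof. by apply: eq_bigr => i _; rewrite mulrC. Qed.

Lemma dotpDl u v w : dotp (u + v) w = dotp u w + dotp v w.
Proof. by rewrite -big_split; apply: eq_bigr => i _; rewrite mxE mulrDl. Qed.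

Lemma dotpZl k u v : dotp (k *: u) v = k * dotp u v.
Proof. by rewrite mulr_sumr; apply: eq_bigr => i _; rewrite mxE mulrA. Qed.

Lemma dotpNl u v : dotp (- u) v = - dotp u v.
Proof. by rewrite -scaleN1r dotpZl mulN1r. Qed.

Lemma dotpDr u v w : dotp u (v + w) = dotp u v + dotp u w.
Proof. by rewrite dotpC dotpDl !(dotpC u). Qed.

Lemma dotpZr k u v : dotp u (k *: v) = k * dotp u v.
Proof. by rewrite dotpC dotpZl dotpC. Qed.

Lemma dotpNr u v : dotp u (- v) = - dotp u v.
Proof. by rewrite dotpC dotpNl dotpC. Qed.

Definition dotpE := (dotpDl, dotpDr, dotpNl, dotpNr, dotpZl, dotpZr).

Lemma dotp_ge0 u : 0 <= dotp u u.
Proof. by apply: sumr_ge0 => i _; rewrite -expr2 sqr_ge0. Qed.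

Lemma dotp_eq0 u : (dotp u u == 0) = (u == 0).
Proof.
apply/idP/eqP => [|->]; last by rewrite /dotp big1 // => i _; rewrite mxE mul0r.
rewrite psumr_eq0 => [/allP u0|i _]; last by rewrite -expr2 sqr_ge0.
apply/rowP => i; rewrite mxE; apply/eqP.
by have := u0 i (mem_index_enum i); rewrite /= mulf_eq0 orbb.
Qed.

Definition enorm u : R := Num.sqrt (dotp u u).

Lemma enorm_ge0 u : 0 <= enorm u.
Proof. exact: sqrtr_ge0. Qed.

Lemma sqr_enorm u : enorm u ^+ 2 = dotp u u.
Proof. by rewrite sqr_sqrtr ?dotp_ge0. Qed.

Lemma enorm_gt0 u : (0 < enorm u) = (u != 0).
Proof. by rewrite lt_def enorm_ge0 andbT sqrtr_eq0 -dotp_eq0 eq_le dotp_ge0 andbT. Qed.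

Lemma enormN u : enorm (- u) = enorm u.
Proof. by rewrite /enorm !dotpE opprK. Qed.

Lemma enorm_distC u v : enorm (u - v) = enorm (v - u).
Proof. by rewrite -enormN opprB. Qed.

Lemma cauchy_schwarz u v : `|dotp u v| <= enorm u * enorm v.
Proof.
have [->|v0] := eqVneq v 0.
  by rewrite -(scale0r v) dotpZr mul0r normr0 mulr_ge0 ?enorm_ge0.
rewrite -(ler_pXn2r (n := 2)) ?nnegrE ?mulr_ge0 ?enorm_ge0 //.
rewrite real_normK ?num_real // exprMn !sqr_enorm.
have vv : 0 < dotp v v by rewrite lt_def dotp_eq0 v0 dotp_ge0.
(* The squared length of the component of u orthogonal to v. *)
have := dotp_ge0 (dotp v v *: u - dotp u v *: v).
rewrite !dotpE (dotpC v u) => H.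
rewrite -subr_ge0 -(pmulr_rge0 _ vv).
by move: H; congr (0 <= _); ring.
Qed.

Lemma le_dotp u v : dotp u v <= enorm u * enorm v.
Proof. exact: le_trans (ler_norm _) (cauchy_schwarz u v). Qed.

Lemma dotp_unit_itv u v : dotp u u = 1 -> dotp v v = 1 -> -1 <= dotp u v <= 1.
Proof.
move=> u1 v1; rewrite -ler_norml (le_trans (cauchy_schwarz u v)) //.
by rewrite /enorm u1 v1 sqrtr1 mulr1.
Qed.

(** The equality case of the Cauchy-Schwarz inequality. *)
Lemma collinear_unit V P : dotp P P = 1 ->
  dotp V V <= dotp V P ^+ 2 -> V = dotp V P *: P.
Proof.
move=> P1 VP; apply/eqP; rewrite -subr_eq0 -dotp_eq0 eq_le dotp_ge0 andbT.
have -> : dotp (V - dotp V P *: P) (V - dotp V P *: P)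
    = dotp V V - dotp V P ^+ 2 by rewrite !dotpE P1 (dotpC P V); ring.
by rewrite subr_le0.
Qed.

(** If the spherical disc of centre P and radius r lies in the half-space of
    inner normal V, the angle between P and V is at most pi/2 - r.  The
    constraint is tight at the point of the disc farthest from V, which is
    obtained by moving P by the angle r away from V. *)
Lemma cap_in_halfspace P V r : dotp P P = 1 -> 0 <= r -> r <= pi / 2 ->
  (forall X, dotp X X = 1 -> acos (dotp P X) <= r -> 0 <= dotp V X) ->
  sin r * enorm V <= dotp V P.
Proof.
move=> PP r0 rpi capV.
have s0 : 0 <= sin r by apply: sin_ge0_pi; rewrite r0 /=; have := pi_ge0 R; lra.
have VP0 : 0 <= dotp V P by apply: capV; rewrite ?PP ?acos1.
have sc := cos2Dsin2 r.
have VPle : dotp V P ^+ 2 <= enorm V ^+ 2.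
  rewrite ler_pXn2r ?nnegrE ?enorm_ge0 //.
  by rewrite (le_trans (le_dotp V P)) // {2}/enorm PP sqrtr1 mulr1.
(* No direction leads away from V when P is parallel to it. *)
have [e|ne] := eqVneq (V - dotp V P *: P) 0.
  have -> : enorm V = dotp V P.
    move/eqP: e; rewrite subr_eq0 => /eqP e.
    by rewrite /enorm e !dotpE PP !mulr1 sqrtr_sqr ger0_norm.
  by rewrite ler_piMl // sin_le1.
set W := V - _ in ne.
have q0 : 0 < enorm W by rewrite enorm_gt0.
have q2 : enorm W ^+ 2 = enorm V ^+ 2 - dotp V P ^+ 2.
  by rewrite !sqr_enorm !dotpE PP (dotpC P V); ring.
have PW : dotp P W = 0 by rewrite !dotpE PP (dotpC P V); ring.
have VW : dotp V W = enorm W ^+ 2 by rewrite q2 sqr_enorm !dotpE; ring.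
move: (W) q0 q2 PW VW => {ne}{}W q0 q2 PW VW.
pose X := cos r *: P - (sin r / enorm W) *: W.
have XX : dotp X X = 1.
  rewrite !dotpE PP (dotpC W P) PW -sqr_enorm -[RHS]sc.
  by field; rewrite gt_eqF.
have PX : dotp P X = cos r by rewrite !dotpE PP PW; ring.
have := capV X XX; rewrite PX cosK; last first.
  by rewrite in_itv /= r0 /=; have := pi_ge0 R; lra.
move=> /(_ (lexx _)).
have -> : dotp V X = cos r * dotp V P - sin r * enorm W.
  by rewrite !dotpE VW; field; rewrite gt_eqF.
rewrite subr_ge0 => le.
rewrite -(ler_pXn2r (n := 2)) ?nnegrE ?mulr_ge0 ?enorm_ge0 //.
have : (sin r * enorm W) ^+ 2 <= (cos r * dotp V P) ^+ 2.
  rewrite ler_pXn2r ?nnegrE ?mulr_ge0 ?(ltW q0) //.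
  by apply: cos_ge0_pihalf; have := pi_ge0 R; lra.
rewrite !exprMn q2.
have -> : cos r ^+ 2 = 1 - sin r ^+ 2 by rewrite -sc; ring.
lra.
Qed.

End DotProduct.

(** * Cross and triple products *)

Section CrossProduct.
Variable R : realType.
Implicit Types (u v w x : 'rV[R]_3).

(** Indices are taken modulo 3, which makes the three coordinates cyclic. *)
Definition cross u v : 'rV[R]_3 :=
  \row_i (u 0 (i + 1) * v 0 (i + 2%:R) - u 0 (i + 2%:R) * v 0 (i + 1)).

Lemma dotp3E u v :
  dotp u v = u 0 0 * v 0 0 + u 0 1 * v 0 1 + u 0 2%:R * v 0 2%:R.
Proof.
rewrite /dotp !big_ord_recl big_ord0 addr0 addrA.
by do 3 f_equal; do ?[f_equal]; apply: val_inj.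
Qed.

Lemma crossE u v :
  (cross u v 0 0 = u 0 1 * v 0 2%:R - u 0 2%:R * v 0 1) *
  (cross u v 0 1 = u 0 2%:R * v 0 0 - u 0 0 * v 0 2%:R) *
  (cross u v 0 2%:R = u 0 0 * v 0 1 - u 0 1 * v 0 0).
Proof.
have e12 : (1 + 2%:R : 'I_3) = 0 by apply: val_inj.
have e21 : (2%:R + 1 : 'I_3) = 0 by apply: val_inj.
have e22 : (2%:R + 2%:R : 'I_3) = 1 by apply: val_inj.
have e11 : (1 + 1 : 'I_3) = 2%:R by apply: val_inj.
by do !split; rewrite mxE ?add0r ?e12 ?e21 ?e22 ?e11.
Qed.

Definition triple u v w := dotp u (cross v w).

Lemma triple_rot u v w : triple u v w = triple v w u.
Proof. rewrite /triple !dotp3E !crossE; ring. Qed.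

Lemma triple_det u v w :
  triple u v w = \det (\matrix_(i < 3) [:: u; v; w]`_i).
Proof.
(* Reading coordinates through natural numbers lets the lifted ordinals of
   the cofactor expansion compute. *)
have [f E] : exists f : 'rV[R]_3 -> nat -> R, forall x (i : 'I_3), x 0 i = f x i.
  by exists (fun x k => x 0 (inord k)) => x i; rewrite inord_val.
rewrite (expand_det_row _ 0).
rewrite !big_ord_recl big_ord0 /cofactor !(expand_det_row _ 0).
rewrite !big_ord_recl !big_ord0 /cofactor !det_mx11 !mxE /=.
rewrite /triple !dotp3E !crossE !E /= /bump /=; ring.
Qed.

Lemma cross_orthogonal u v : (dotp u (cross u v) = 0) * (dotp v (cross u v) = 0).
Proof. by split; rewrite !dotp3E !crossE; ring. Qed.

(** The Gram determinant of three vectors. *)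
Lemma sqr_triple u v w : triple u v w ^+ 2 =
  dotp u u * dotp v v * dotp w w + 2 * dotp u v * dotp v w * dotp w u
  - dotp u u * dotp v w ^+ 2 - dotp v v * dotp w u ^+ 2
  - dotp w w * dotp u v ^+ 2.
Proof. by rewrite /triple !dotp3E !crossE; ring. Qed.

Lemma dotp_cross u v w x :
  dotp (cross u v) (cross w x) = dotp u w * dotp v x - dotp u x * dotp v w.
Proof. by rewrite !dotp3E !crossE; ring. Qed.

Lemma triple_eq0 u v w : triple u v w = 0 ->
  exists n, [/\ n != 0, dotp n u = 0, dotp n v = 0 & dotp n w = 0].
Proof.
rewrite triple_det => /eqP; rewrite -det_tr => /det0P[n n0 /rowP nM].
have nE (i : 'I_3) : dotp n [:: u; v; w]`_i = 0.
  by have := nM i; rewrite !mxE => <-; apply: eq_bigr => j _; rewrite !mxE.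
by exists n; split; [|exact: nE 0|exact: nE 1|exact: nE 2%:R].
Qed.

End CrossProduct.

(** * Discs inscribed in a spherical triangle *)

Section SphericalBound.
Variable R : realType.
Implicit Types (A B C N P X V : 'rV[R]_3) (d r : R).
Local Open Scope classical_set_scope.

Lemma sregion_rot A B C : sregion A B C `<=` sregion B C A.
Proof.
move=> X [X1 [s [t [u [s0 t0 u0 XE]]]]]; split => //=; rewrite XE.
by exists t, u, s; split => //; rewrite -addrA addrC.
Qed.

Lemma sregion_swap A B C : sregion A B C `<=` sregion A C B.
Proof.
move=> X [X1 [s [t [u [s0 t0 u0 XE]]]]]; split => //=; rewrite XE.
by exists s, u, t; split => //; rewrite addrAC.
Qed.

Lemma sregion_halfspace A B C X : 0 < triple A B C -> sregion A B C X ->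
  0 <= dotp (cross B C) X.
Proof.
move=> D0 [_ [s [t [u [s0 _ _ ->]]]]].
rewrite !dotpE !(dotpC (cross B C)) !cross_orthogonal !mulr0 !addr0.
by rewrite mulr_ge0 // ltW.
Qed.

Lemma cap_face A B C P r : dotp P P = 1 -> 0 < triple A B C ->
  0 <= r -> r <= pi / 2 -> sdisc P r `<=` sregion A B C ->
  sin r * enorm (cross B C) <= dotp (cross B C) P.
Proof.
move=> P1 D0 r0 rpi Pr; apply: cap_in_halfspace => // X X1 Xr.
by apply: (sregion_halfspace D0); apply: Pr.
Qed.

(** A closed hemisphere does not fit in a triangle: the bound of
    [cap_face] at radius pi/2 would make two face normals parallel to P, hence
    parallel to each other. *)
Lemma cap_radius_lt A B C P r : dotp P P = 1 -> 0 < triple A B C -> 0 < r ->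
  sdisc P r `<=` sregion A B C -> r < pi / 2.
Proof.
move=> P1 D0 r0 Pr; rewrite ltNge; apply/negP => rpi.
have pi20 : 0 <= pi / 2 :> R by have := pi_ge0 R; lra.
have Ppi : sdisc P (pi / 2) `<=` sregion A B C.
  by move=> X [X1 Xpi]; apply: Pr; split => //; apply: le_trans Xpi rpi.
have face V : enorm V <= dotp V P -> V = dotp V P *: P.
  move=> VP; apply: collinear_unit => //.
  by rewrite -sqr_enorm ler_pXn2r ?nnegrE ?enorm_ge0 // (le_trans _ VP) ?enorm_ge0.
have DBCA : 0 < triple B C A by rewrite -triple_rot.
have Va : cross B C = dotp (cross B C) P *: P.
  by apply: face; have := cap_face P1 D0 pi20 (lexx _) Ppi; rewrite sin_pihalf mul1r.
have Vb : cross C A = dotp (cross C A) P *: P.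
  apply: face; have := cap_face P1 DBCA pi20 (lexx _) (subset_trans Ppi (@sregion_rot A B C)).
  by rewrite sin_pihalf mul1r.
have Aa : triple A B C = dotp (cross B C) P * dotp A P by rewrite /triple {1}Va dotpZr.
have Bb : triple B C A = dotp (cross C A) P * dotp B P by rewrite /triple {1}Vb dotpZr.
have /eqP : dotp (cross C A) P * dotp A P = 0.
  by rewrite -dotpZr -Vb cross_orthogonal.
rewrite mulf_eq0 => /orP[/eqP e|/eqP e].
- by move: DBCA; rewrite Bb e mul0r ltxx.
- by move: D0; rewrite Aa e mulr0 ltxx.
Qed.

(** Since N x (B x C) = d (B - C), the component of B x C orthogonal to N has
    length d * |C - B|; the inequality is then the Cauchy-Schwarz inequality
    in the plane against (sin r, cos r). *)
Lemma chord_le_cross B C N d r : dotp N N = 1 -> 0 < d ->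
  dotp N B = d -> dotp N C = d ->
  sin r * dotp (cross B C) N + cos r * (d * enorm (C - B)) <= enorm (cross B C).
Proof.
move=> N1 d0 NB NC.
have V2 : enorm (cross B C) ^+ 2
    = dotp (cross B C) N ^+ 2 + (d * enorm (C - B)) ^+ 2.
  rewrite exprMn !sqr_enorm dotp_cross (dotpC _ N) -/(triple N B C) sqr_triple.
  by rewrite !dotpE N1 (dotpC C N) (dotpC C B) NB NC; ring.
apply: le_trans (ler_norm _) _.
rewrite -(ler_pXn2r (n := 2)) ?nnegrE ?enorm_ge0 // real_normK ?num_real //.
rewrite V2; set p := dotp _ _; set q := d * _.
rewrite -subr_ge0 -[X in X - _]mul1r -(cos2Dsin2 r).
by rewrite [X in 0 <= X](_ : _ = (cos r * p - sin r * q) ^+ 2) ?sqr_ge0 //; ring.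
Qed.

(** Six times the volume of the tetrahedron OABC, as twice the area of the
    base ABC times the height d. *)
Lemma triple_height A B C N d : dotp N N = 1 ->
  dotp N A = d -> dotp N B = d -> dotp N C = d ->
  triple A B C = d * triple N (B - A) (C - A).
Proof.
move=> N1 NA NB NC.
have : triple A B C * dotp N N = dotp N A * triple N B C
    + dotp N B * triple N C A + dotp N C * triple N A B.
  by rewrite /triple !dotp3E !crossE; ring.
rewrite N1 NA NB NC mulr1 => ->.
by rewrite /triple !dotp3E !crossE !mxE; ring.
Qed.

(** The heart of the matter.  The triple product on the right is twice the
    area of the chord triangle, so this bounds its inradius below by
    d * tan r. *)
Lemma cos_tan_inradius A B C N P d r :
  dotp N N = 1 -> dotp P P = 1 -> 0 < d ->
  dotp N A = d -> dotp N B = d -> dotp N C = d ->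
  0 < triple A B C -> 0 < r -> sdisc P r `<=` sregion A B C ->
  d * tan r * (enorm (C - B) + enorm (A - C) + enorm (B - A))
    <= triple N (B - A) (C - A).
Proof.
move=> N1 P1 d0 NA NB NC D0 r0 Pr.
have rpi := cap_radius_lt P1 D0 r0 Pr.
have s0 : 0 < sin r by apply: sin_gt0_pi; rewrite r0 /=; have := pi_ge0 R; lra.
have c0 : 0 < cos r by apply: cos_gt0_pihalf; rewrite rpi andbT; lra.
set T := triple N _ _.
set S := cross (B - A) (C - A).
have SE : S = cross B C + cross C A + cross A B.
  by apply/rowP => i; rewrite !mxE; ring.
(* Both edges B - A and C - A are orthogonal to N. *)
have ST : S = T *: N.
  rewrite /T /triple -/S (dotpC N); apply: collinear_unit => //.
  rewrite (dotpC S N) -/(triple N _ _) sqr_triple /S dotp_cross.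
  rewrite (dotpC (C - A) N) (dotpC (C - A) (B - A)).
  have -> : dotp N (B - A) = 0 by rewrite !dotpE NA NB subrr.
  have -> : dotp N (C - A) = 0 by rewrite !dotpE NA NC subrr.
  by rewrite N1; lra.
have T0 : 0 < T.
  by move: D0; rewrite (triple_height N1 NA NB NC) pmulr_rgt0.
have r0' := ltW r0; have rpi' := ltW rpi.
have D1 : 0 < triple B C A by rewrite -triple_rot.
have D2 : 0 < triple C A B by rewrite -triple_rot.
have Pr1 := subset_trans Pr (@sregion_rot A B C).
have Pr2 := subset_trans Pr1 (@sregion_rot B C A).
have fa := cap_face P1 D0 r0' rpi' Pr.
have fb := cap_face P1 D1 r0' rpi' Pr1.
have fc := cap_face P1 D2 r0' rpi' Pr2.
have ka := chord_le_cross r N1 d0 NB NC.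
have kb := chord_le_cross r N1 d0 NC NA.
have kc := chord_le_cross r N1 d0 NA NB.
have SN : dotp (cross B C) N + dotp (cross C A) N + dotp (cross A B) N = T.
  by rewrite -!dotpDl -SE ST dotpZl N1 mulr1.
have SP : dotp (cross B C) P + dotp (cross C A) P + dotp (cross A B) P <= T.
  rewrite -!dotpDl -SE ST dotpZl ler_piMr ?(ltW T0) //.
  by rewrite (le_trans (le_dotp N P)) // /enorm N1 P1 sqrtr1 mulr1.
set L := enorm _ + _ + _.
set W := enorm (cross B C) + enorm (cross C A) + enorm (cross A B).
have k : sin r * T + cos r * (d * L) <= W by rewrite -SN /L /W; lra.
have f : sin r * W <= T by rewrite /W; lra.
(* With sin^2 + cos^2 = 1, a common factor cos r cancels from the sum. *)
have : sin r * (sin r * T + cos r * (d * L)) <= T.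
  by apply: le_trans f; rewrite ler_pM2l.
rewrite -[leRHS]mul1r -(cos2Dsin2 r) => H.
rewrite -(ler_pM2l (exprn_gt0 2 c0)).
have -> : cos r ^+ 2 * (d * tan r * L) = sin r * (cos r * (d * L)).
  by rewrite /tan; field; rewrite gt_eqF.
lra.
Qed.

Lemma cos_tan_inradius_unoriented A B C N P d r :
  dotp N N = 1 -> dotp P P = 1 -> 0 < d ->
  dotp N A = d -> dotp N B = d -> dotp N C = d ->
  triple A B C != 0 -> 0 < r -> sdisc P r `<=` sregion A B C ->
  0 < tan r /\
  d * tan r * (enorm (C - B) + enorm (A - C) + enorm (B - A))
    <= `|triple N (B - A) (C - A)|.
Proof.
move=> N1 P1 d0 NA NB NC D0 r0 Pr.
have tan0 : r < pi / 2 -> 0 < tan r.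
  move=> rpi; have pi0 := pi_ge0 R.
  by rewrite /tan divr_gt0 ?sin_gt0_pi ?cos_gt0_pihalf ?r0 ?rpi //=; lra.
move: D0; rewrite neq_lt => /orP[D0|D0]; last first.
  split; first exact/tan0/(cap_radius_lt P1 D0 r0 Pr).
  exact: le_trans (cos_tan_inradius N1 P1 d0 NA NB NC D0 r0 Pr) (ler_norm _).
have D0' : 0 < triple A C B.
  by rewrite -oppr_gt0 in D0; rewrite (_ : triple A C B = - triple A B C) //
     /triple !dotp3E !crossE; ring.
have Pr' := subset_trans Pr (@sregion_swap A B C).
split; first exact/tan0/(cap_radius_lt P1 D0' r0 Pr').
rewrite -normrN (le_trans _ (ler_norm _)) //.
have := cos_tan_inradius N1 P1 d0 NA NC NB D0' r0 Pr'.
rewrite (enorm_distC B C) (enorm_distC A B) (enorm_distC C A).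
rewrite (addrAC (enorm _)) (_ : triple N (C - A) (B - A) = - triple N (B - A) (C - A)) //.
by rewrite /triple !dotp3E !crossE; ring.
Qed.

End SphericalBound.

(** * The incircle of a plane triangle *)

Section PlaneTriangle.
Variable R : realType.
Implicit Types (A B C P X u v w : 'rV[R]_2) (rho : R).
Local Open Scope classical_set_scope.

Definition det2 u v : R := u 0 0 * v 0 1 - u 0 1 * v 0 0.

Lemma dotp2E u v : dotp u v = u 0 0 * v 0 0 + u 0 1 * v 0 1.
Proof.
rewrite /dotp !big_ord_recl big_ord0 addr0.
by do 3 f_equal; apply: val_inj.
Qed.

Lemma sqr_det2 u v : det2 u v ^+ 2 = dotp u u * dotp v v - dotp u v ^+ 2.
Proof. by rewrite /det2 !dotp2E; ring. Qed.

Lemma le_det2 u v : `|det2 u v| <= enorm u * enorm v.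
Proof.
rewrite -(ler_pXn2r (n := 2)) ?nnegrE ?mulr_ge0 ?enorm_ge0 //.
rewrite real_normK ?num_real // exprMn !sqr_enorm sqr_det2.
by rewrite lerBlDr lerDl sqr_ge0.
Qed.

Lemma det2_rot A B C : det2 (C - B) (A - B) = det2 (B - A) (C - A).
Proof. by rewrite /det2 !mxE; ring. Qed.

Lemma det2_euclidean_triangle A B C :
  det2 (B - A) (C - A) != 0 -> euclidean_triangle A B C.
Proof.
move=> D0 [n [c [n0 nA nB nC]]].
have nv : dotp n (B - A) = 0 by rewrite !dotpE nA nB subrr.
have nw : dotp n (C - A) = 0 by rewrite !dotpE nA nC subrr.
(* Up to a quarter turn, det2 v w *: n is (n . v) w - (n . w) v. *)
have : det2 (B - A) (C - A) ^+ 2 * dotp n n =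
    dotp n (B - A) ^+ 2 * dotp (C - A) (C - A)
    - 2 * dotp n (B - A) * dotp n (C - A) * dotp (B - A) (C - A)
    + dotp n (C - A) ^+ 2 * dotp (B - A) (B - A).
  by rewrite /det2 !dotp2E; ring.
rewrite nv nw expr0n !(mul0r, mulr0) subr0 addr0 => /eqP.
by rewrite mulf_eq0 expf_eq0 /= dotp_eq0 (negbTE D0) (negbTE n0).
Qed.

(** P is at distance rho from the line AB, and the two sign conditions put
    the foot of the perpendicular from P on the segment; by Pythagoras every
    other point of the segment is farther from P. *)
Lemma etangent_foot P rho A B : A != B -> 0 <= rho ->
  det2 (A - P) (B - P) ^+ 2 = rho ^+ 2 * dotp (B - A) (B - A) ->
  0 <= dotp (P - A) (B - A) -> 0 <= dotp (P - B) (A - B) ->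
  etangent P rho A B.
Proof.
move=> AB rho0 dist PA PB.
set q := dotp (B - A) (B - A) in dist.
have q0 : 0 < q by rewrite lt_def dotp_eq0 subr_eq0 eq_sym AB dotp_ge0.
set k := dotp (P - A) (B - A) in PA.
(* t = k / q is the affine coordinate of the foot. *)
have pyth s t : s + t = 1 ->
    q * dotp (s *: A + t *: B - P) (s *: A + t *: B - P)
    = q * rho ^+ 2 + (q * t - k) ^+ 2.
  move=> st; have -> : s = 1 - t by rewrite -st addrK.
  by rewrite (mulrC q (rho ^+ 2)) -dist /q /k /det2 !dotp2E !mxE; ring.
have st : dotp (P - B) (A - B) / q + k / q = 1.
  apply: (mulIf (lt0r_neq0 q0)); rewrite mulrDl !divfK ?gt_eqF // mul1r.
  by rewrite /q /k !dotp2E !mxE; ring.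
exists ((dotp (P - B) (A - B) / q) *: A + (k / q) *: B); split.
  split; first by exists (dotp (P - B) (A - B) / q), (k / q); split; rewrite ?divr_ge0 ?(ltW q0).
  rewrite /ecircle /= /euclidean_dist.
  rewrite [X in Num.sqrt X](_ : _ = rho ^+ 2) ?sqrtr_sqr ?ger0_norm //.
  apply: (mulfI (lt0r_neq0 q0)); rewrite pyth // (mulrC q (k / q)) divfK ?gt_eqF //.
  by rewrite subrr expr0n addr0.
move=> X [[s [t [s0 t0 st' ->]]]]; rewrite /ecircle /= => dX.
have : q * dotp (s *: A + t *: B - P) (s *: A + t *: B - P) = q * rho ^+ 2.
  by rewrite -dX sqr_sqrtr ?dotp_ge0.
rewrite pyth // => /eqP; rewrite -[X in _ == X]addr0 (inj_eq (addrI _)).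
rewrite expf_eq0 /= subr_eq0 => /eqP e.
have tE : k / q = t by rewrite -e mulrC mulKf ?gt_eqF.
congr (_ *: _ + _ *: _) => //.
by apply: (addIr t); rewrite st' -tE.
Qed.

Definition perimeter A B C := enorm (C - B) + enorm (A - C) + enorm (B - A).

(** The barycentric coordinates of the incentre are proportional to the
    lengths of the opposite sides. *)
Definition incenter A B C : 'rV[R]_2 := (perimeter A B C)^-1 *:
  (enorm (C - B) *: A + enorm (A - C) *: B + enorm (B - A) *: C).

(** Cutting the triangle at the incentre, its area is half the product of this
    radius and the perimeter. *)
Definition inradius A B C := `|det2 (B - A) (C - A)| / perimeter A B C.

Lemma perimeter_rot A B C : perimeter B C A = perimeter A B C.
Proof. by rewrite /perimeter addrC addrA. Qed.

Lemma incenter_rot A B C : incenter B C A = incenter A B C.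
Proof. by rewrite /incenter perimeter_rot; congr (_ *: _); rewrite addrC addrA. Qed.

Lemma inradius_rot A B C : inradius B C A = inradius A B C.
Proof. by rewrite /inradius perimeter_rot det2_rot. Qed.

Lemma det2_neq A B C : det2 (B - A) (C - A) != 0 -> B != C.
Proof.
by apply: contraNneq => ->; rewrite /det2 mulrC subrr.
Qed.

Lemma perimeter_gt0 A B C : det2 (B - A) (C - A) != 0 -> 0 < perimeter A B C.
Proof.
move=> /det2_neq BC; rewrite /perimeter -addrA ltr_pwDl ?addr_ge0 ?enorm_ge0 //.
by rewrite enorm_gt0 subr_eq0 eq_sym.
Qed.

Lemma det2_incenter A B C : det2 (B - A) (C - A) != 0 ->
  det2 (B - incenter A B C) (C - incenter A B C)
  = enorm (C - B) / perimeter A B C * det2 (B - A) (C - A).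
Proof.
move=> /perimeter_gt0; rewrite /incenter; set L := perimeter A B C => L0.
have cE : enorm (B - A) = L - enorm (C - B) - enorm (A - C).
  by rewrite /L /perimeter; ring.
by rewrite cE /det2 !mxE; field; rewrite gt_eqF.
Qed.

Lemma incircle_tangent A B C : det2 (B - A) (C - A) != 0 ->
  etangent (incenter A B C) (inradius A B C) B C.
Proof.
move=> D0; have L0 := perimeter_gt0 D0.
have := det2_incenter D0.
rewrite /inradius /incenter; set L := perimeter A B C in L0 *; set I := L^-1 *: _ => DI.
apply: etangent_foot; first exact: det2_neq D0.
- by rewrite divr_ge0 // ltW.
- by rewrite DI -sqr_enorm !exprMn real_normK ?num_real //; ring.
- have -> : dotp (I - B) (C - B) = (enorm (C - B) * dotp (A - B) (C - B)
      + enorm (B - A) * enorm (C - B) ^+ 2) / L.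
    rewrite /I sqr_enorm; set a := enorm (C - B); set c := enorm (B - A).
    have -> : enorm (A - C) = L - a - c by rewrite /L /perimeter -/a -/c; ring.
    by rewrite !dotp2E !mxE; field; rewrite gt_eqF.
  rewrite divr_ge0 ?(ltW L0) // mulrC expr2 mulrA -mulrDl mulr_ge0 ?enorm_ge0 //.
  have := cauchy_schwarz (A - B) (C - B).
  by rewrite ler_norml (enorm_distC A B) => /andP[+ _]; lra.
- have -> : dotp (I - C) (B - C) = (enorm (C - B) * dotp (A - C) (B - C)
      + enorm (A - C) * enorm (C - B) ^+ 2) / L.
    rewrite /I sqr_enorm; set a := enorm (C - B); set b := enorm (A - C).
    have -> : enorm (B - A) = L - a - b by rewrite /L /perimeter -/a -/b; ring.
    by rewrite !dotp2E !mxE; field; rewrite gt_eqF.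
  rewrite divr_ge0 ?(ltW L0) // mulrC expr2 mulrA -mulrDl mulr_ge0 ?enorm_ge0 //.
  have := cauchy_schwarz (A - C) (B - C).
  by rewrite ler_norml (enorm_distC B C) => /andP[+ _]; lra.
Qed.

(** The quotient is the barycentric coordinate of X at A.  It equals
    |BC| / perimeter at the incentre, and moving by at most the inradius
    changes it by at most that amount. *)
Lemma incircle_barycentric_ge0 A B C X : det2 (B - A) (C - A) != 0 ->
  edisc (incenter A B C) (inradius A B C) X ->
  0 <= det2 (B - X) (C - X) / det2 (B - A) (C - A).
Proof.
move=> D0; have L0 := perimeter_gt0 D0.
rewrite /edisc /= /euclidean_dist -/(enorm _) => dX.
have -> : det2 (B - X) (C - X) = det2 (B - incenter A B C) (C - incenter A B C)
    - det2 (X - incenter A B C) (C - B).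
  by rewrite /det2 !mxE; ring.
rewrite det2_incenter // mulrBl mulfK // subr_ge0.
apply: le_trans (ler_norm _) _; rewrite normrM normfV.
rewrite ler_pdivrMr ?normr_gt0 // (le_trans (le_det2 _ _)) //.
rewrite mulrC -mulrA ler_wpM2l ?enorm_ge0 // (le_trans dX) //.
by rewrite /inradius mulrC.
Qed.

Lemma euclidean_inradiusP A B C : det2 (B - A) (C - A) != 0 ->
  euclidean_inradius A B C (inradius A B C).
Proof.
move=> D0; have L0 := perimeter_gt0 D0.
have D1 : det2 (C - B) (A - B) != 0 by rewrite det2_rot.
have D2 : det2 (A - C) (B - C) != 0 by rewrite det2_rot.
split; first by rewrite divr_gt0 ?normr_gt0.
exists (incenter A B C); split.
  move=> X dX; have sa := incircle_barycentric_ge0 D0 dX.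
  move: dX; rewrite -incenter_rot -inradius_rot => dX.
  have sb := incircle_barycentric_ge0 D1 dX.
  move: dX; rewrite -incenter_rot -inradius_rot => dX.
  have sc := incircle_barycentric_ge0 D2 dX.
  rewrite (det2_rot A B C) in sb; rewrite (det2_rot B C A) (det2_rot A B C) in sc.
  have DE := D0; rewrite /det2 !mxE in DE.
  eexists _, _, _; split; [exact: sa|exact: sb|exact: sc| |].
    apply: (mulIf D0); rewrite !mulrDl !divfK // mul1r.
    by rewrite /det2 !mxE; ring.
  apply/rowP => i; rewrite !mxE /det2 !mxE.
  have [->|->] : i = 0 \/ i = 1 by case: i => [[|[|//]] ?]; [left|right]; apply: val_inj.
  - by field.
  - by field.
split; first exact: incircle_tangent.
- by rewrite -incenter_rot -inradius_rot; apply: incircle_tangent.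
- by rewrite -2!incenter_rot -2!inradius_rot; apply: incircle_tangent.
Qed.

End PlaneTriangle.

(** * From the chord plane to the coordinate plane *)

Section PlaneSection.
Variable R : realType.
Implicit Types (N e u v w : 'rV[R]_3).

(** Coordinates in the basis (e, N x e) of the plane orthogonal to N, halved
    so that chords become half-chords. *)
Definition half_chart N e u : 'rV[R]_2 :=
  2^-1 *: \row_(i < 2) [:: dotp u e; dotp u (cross N e)]`_i.

Lemma half_chartB N e u v : half_chart N e (u - v) = half_chart N e u - half_chart N e v.
Proof.
by apply/rowP => i; case: i => [[|[|//]] ?]; rewrite !mxE /= !dotpE mulrBr.
Qed.

Lemma enorm_half_chart N e u : dotp N N = 1 -> dotp e e = 1 -> dotp N e = 0 ->
  enorm (half_chart N e u) = Num.sqrt (dotp u u - dotp N u ^+ 2) / 2.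
Proof.
move=> N1 e1 Ne; rewrite /enorm.
have -> : dotp (half_chart N e u) (half_chart N e u)
    = (dotp u u - dotp N u ^+ 2) * 2^-1 ^+ 2.
  rewrite dotp2E !mxE /= -/(triple u N e).
  have -> : dotp u u - dotp N u ^+ 2 = dotp u e ^+ 2 + triple u N e ^+ 2.
    by rewrite sqr_triple N1 e1 Ne (dotpC e u) (dotpC u N); ring.
  ring.
by rewrite mulrC sqrtrM ?sqr_ge0 // mulrC sqrtr_sqr ger0_norm // invr_ge0.
Qed.

Lemma det2_half_chart N e u v : dotp e e = 1 -> dotp N e = 0 ->
  det2 (half_chart N e u) (half_chart N e v) = triple N u v / 4.
Proof.
move=> e1 Ne; rewrite /det2 !mxE /=.
have : dotp u e * dotp v (cross N e) - dotp u (cross N e) * dotp v e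
    = triple N u v * dotp e e - dotp N e * triple e u v.
  by rewrite /triple !dotp3E !crossE; ring.
by rewrite e1 Ne mulr1 mul0r subr0 => <-; field.
Qed.

End PlaneSection.

Lemma sin_half_spherical_dist (R : realType) (A B : 'rV[R]_3) :
  unit_sphere A -> unit_sphere B ->
  sin (spherical_dist A B / 2) = enorm (B - A) / 2.
Proof.
rewrite /unit_sphere /= => A1 B1.
have AB := dotp_unit_itv A1 B1.
rewrite /spherical_dist; set x := acos _.
have x0 : 0 <= x by apply: acos_ge0.
have xpi : x <= pi by apply: acos_lepi.
have s0 : 0 <= sin (x / 2) by apply: sin_ge0_pi; apply/andP; split; lra.
apply/eqP; rewrite -(eqrXn2 (n := 2)) ?divr_ge0 ?enorm_ge0 //; apply/eqP.
have : cos (x / 2 + x / 2) = dotp A B by rewrite -splitr acosK.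
rewrite cosD => cx; have sc := cos2Dsin2 (x / 2).
rewrite expr_div_n sqr_enorm !dotpE A1 B1 (dotpC B A) -cx.
have -> : sin (x / 2) ^+ 2 = 1 - cos (x/2) ^+ 2 by lra.
by lra.
Qed.
Theorem corollary3p3 (R : realType) (g : R -> R -> R -> R)
  (hg : forall (A B C : 'rV[R]_2) (Rc r : R),
      euclidean_triangle A B C ->
      euclidean_circumradius A B C Rc ->
      euclidean_inradius A B C r ->
      Rc / r >= g (euclidean_dist B C) (euclidean_dist C A) (euclidean_dist A B)) :
  forall (A B C : 'rV[R]_3) (Rc r : R),
    spherical_triangle A B C ->
    spherical_circumradius A B C Rc ->
    spherical_inradius A B C r ->
    tan Rc / tan r >=
      g (sin (spherical_dist B C / 2)) (sin (spherical_dist C A / 2)) (sin (spherical_dist A B / 2)).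
Proof.
move=> A B C Rc r [[A1 B1 C1] ABC] [Rpi [N [N1 [NA NB NC]]]] [r0 [P [P1 Pr _]]].
rewrite !sin_half_spherical_dist //.
move: N1 P1 A1 B1 C1 NA NB NC; rewrite /unit_sphere /= => N1 P1 A1 B1 C1 [_ NA] [_ NB] [_ NC].
have D0 : triple A B C != 0.
  apply/eqP => /triple_eq0[n [n0 nA nB nC]]; apply: ABC; exists n.
  by split=> //; split.
have cosR X : dotp X X = 1 -> spherical_dist N X = Rc -> dotp N X = cos Rc.
  by move=> X1 <-; rewrite /spherical_dist acosK // in_itv /= dotp_unit_itv.
have Rc0 : 0 <= Rc. by rewrite -NA acos_ge0 // dotp_unit_itv.
have pi0 := pi_ge0 R.
have d0 : 0 < cos Rc by apply: cos_gt0_pihalf; rewrite Rpi andbT; lra.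
have s0 : 0 <= sin Rc by apply: sin_ge0_pi; rewrite Rc0 /=; lra.
have {}NA := cosR A A1 NA; have {}NB := cosR B B1 NB; have {}NC := cosR C C1 NC.
have [t0 bound] := cos_tan_inradius_unoriented N1 P1 d0 NA NB NC D0 r0 Pr.
set T := triple N (B - A) (C - A) in bound.
have T0 : T != 0.
  by move: D0; rewrite (triple_height N1 NA NB NC) mulf_eq0 => /norP[].
have BA : B - A != 0.
  by apply: contraNneq T0 => e; rewrite /T e /triple !dotp3E !crossE !mxE; apply/eqP; ring.
set l := enorm (B - A) in bound.
have l0 : 0 < l by rewrite enorm_gt0.
(* The first axis of the chart is the direction of the edge AB. *)
pose e := l^-1 *: (B - A).
have e1 : dotp e e = 1.
  by rewrite dotpZl dotpZr -sqr_enorm -/l; field; rewrite gt_eqF.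
have Ne : dotp N e = 0 by rewrite !dotpE NA NB subrr mulr0.
pose f := half_chart N e.
have fdist X Y : dotp N X = cos Rc -> dotp N Y = cos Rc ->
    enorm (f Y - f X) = enorm (Y - X) / 2.
  move=> NX NY; rewrite /f -half_chartB enorm_half_chart //.
  by rewrite [dotp N _]dotpDr dotpNr NX NY subrr expr0n subr0.
have fcirc X : dotp X X = 1 -> dotp N X = cos Rc -> ecircle 0 (sin Rc / 2) (f X).
  move=> X1 NX; rewrite /ecircle /= /euclidean_dist subr0 -/(enorm _).
  rewrite enorm_half_chart // X1 NX -sin2cos2 sqrtr_sqr ger0_norm //.
have fD : det2 (f B - f A) (f C - f A) = T / 4.
  by rewrite /f -!half_chartB det2_half_chart.
have fD0 : det2 (f B - f A) (f C - f A) != 0 by rewrite fD mulf_neq0.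
have fR : euclidean_circumradius (f A) (f B) (f C) (sin Rc / 2).
  by exists 0; split; apply: fcirc.
have := hg _ _ _ _ _ (det2_euclidean_triangle fD0) fR (euclidean_inradiusP fD0).
rewrite /euclidean_dist -!/(enorm _) !fdist // => /le_trans; apply.
set L := _ + _ + _ in bound.
have Tpos : 0 < `|T| by rewrite normr_gt0.
have L0 : 0 < L by rewrite ltr_wpDl ?addr_ge0 ?enorm_ge0.
have -> : inradius (f A) (f B) (f C) = `|T| / (2 * L).
  rewrite /inradius /perimeter fD !fdist // -/l -!mulrDl -/L normrM normfV.
  by rewrite (ger0_norm (ler0n R 4)); field; rewrite gt_eqF.
have -> : sin Rc / 2 / (`|T| / (2 * L)) = sin Rc * L / `|T|.
  by field; rewrite !gt_eqF.
rewrite ler_pdivlMr // mulrAC ler_pdivrMr // {2}/tan.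
rewrite -!(mulrA (sin Rc)) ler_wpM2l // ler_pdivlMl //.
by rewrite mulrCA (mulrC L).
Qed.
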